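(* For any positive integers $n,k$ with $n\ge k+1$, there exists an $(n,k)$-lexicographic line arrangement.
   Context: Write $[n]=\{1,\dots,n\}$. Subsets of $[n]$ of a fixed size are written with elements in increasing order and compared in lexicographic order. For a point $P\in\mathbb{R}^2$, $x(P)$ denotes its $x$-coordinate. No line in the arrangement is vertical. An $(n,k)$-lexicographic line arrangement is a real line arrangement in $\mathbb{R}^2$ consisting of lines $l_I$ indexed by the $(k+1)$-subsets $I=\{i_1<i_2<\dots<i_{k+1}\}\subset[n]$, satisfying the following properties. (L1) Let $C$ be a circle containing all intersection points of the lines $l_I$ in its interior. For each $I$, let $C_I$ be the intersection point of $C$ and $l_I$ lying on the ray of $l_I$ in the direction of increasing $x$-coordinate. Then the points $C_I$ appear in lexicographic order with respect to the indices $I$ when going along $C$ clockwise starting from $C_{\{1,2,\dots,k+1\}}$. (L2) The intersection points are of exactly the following two types: a double point $P_{I\mid J}=l_I\cap l_J$ when $|I\cap J|<k$; and a $(k+2)$-multiple point $P_L=\bigcap_{j=1}^{k+2} l_{L\setminus\{i_j\}}$ associated with each $(k+2)$-subset $L=\{i_1<i_2<\dots<i_{k+2}\}\subset[n]$. (L3) The $(k+2)$-multiple points are totally ordered by their $x$-coordinates so that $x(P_{L'})<x(P_L)$ whenever $L<L'$ in lexicographic order. *)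

(* Defs.v *)
From HB Require Import structures.
From mathcomp Require Import all_boot all_order all_algebra.
From mathcomp Require Import all_classical all_reals all_analysis.

Set Implicit Arguments.
Unset Strict Implicit.
Unset Printing Implicit Defensive.

Import Order.TTheory GRing.Theory Num.Theory.

Local Open Scope classical_set_scope.
Local Open Scope ring_scope.

(* [n] is represented by 'I_n = {0, ..., n-1}; [enum I] lists the elements of
   I in increasing order. *)
Definition lexlt (n : nat) (I J : {set 'I_n}) : bool :=
  ((enum I : seqlexi 'I_n) < (enum J : seqlexi 'I_n))%O.

Section Plane.
Variable R : realType.
Implicit Types (p q c : R * R) (A : set (R * R)).

Definition is_line A : Prop :=
  exists a b d : R,
    (a, b) <> (0, 0) /\ A = [set p | a * p.1 + b * p.2 = d].

Definition vertical A : Prop := exists d : R, A = [set p | p.1 = d].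

Definition circle c (r : R) : set (R * R) :=
  [set p | (p.1 - c.1) ^+ 2 + (p.2 - c.2) ^+ 2 = r ^+ 2].

Definition circle_interior c (r : R) : set (R * R) :=
  [set p | (p.1 - c.1) ^+ 2 + (p.2 - c.2) ^+ 2 < r ^+ 2].

(* Of the (at most two) points where the line A meets the circle, p is the one
   reached when following A in the direction of increasing x-coordinate. *)
Definition right_endpoint c (r : R) A p : Prop :=
  (circle c r `&` A) p /\ forall q, (circle c r `&` A) q -> q.1 <= p.1.

Definition circle_point c (r theta : R) : R * R :=
  (c.1 + r * cos theta, c.2 + r * sin theta).

(* Going clockwise along the circle from p, one first meets q after turning
   by the angle t. *)
Definition clockwise_angle c (r : R) p q (t : R) : Prop :=
  0 <= t < 2 * pi /\
  exists theta : R,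
    p = circle_point c r theta /\ q = circle_point c r (theta - t).

End Plane.

(* The lines are indexed by the (k+1)-subsets of [n]; the values of l at
   subsets of other cardinalities are irrelevant and never constrained. *)
Section Arrangement.
Variables (R : realType) (n k : nat) (l : {set 'I_n} -> set (R * R)).
Implicit Types (I J L : {set 'I_n}) (p q : R * R).

Definition line_arrangement : Prop :=
  (forall I, #|I| = k.+1 -> is_line (l I) /\ ~ vertical (l I)) /\
  (forall I J, #|I| = k.+1 -> #|J| = k.+1 -> l I = l J -> I = J).

Definition intersection_point p : Prop :=
  exists I J, [/\ #|I| = k.+1, #|J| = k.+1, I <> J & (l I `&` l J) p].

Definition first_index : {set 'I_n} := [set i : 'I_n | (i < k.+1)%N]%SET.

Definition appear_clockwise (c : R * R) (r : R)
    (C : {set 'I_n} -> R * R) : Prop :=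
  exists t : {set 'I_n} -> R,
    (forall I, #|I| = k.+1 ->
       clockwise_angle c r (C first_index) (C I) (t I)) /\
    (forall I J, #|I| = k.+1 -> #|J| = k.+1 -> lexlt I J -> t I < t J).

(* That the circle meets every line is automatic as soon as there are at least
   two lines, since by [lexL2] each line then contains an intersection point.
   The hypothesis only matters for n = k+1, where there is a single line and no
   intersection point. *)
Definition lexL1 : Prop :=
  forall (c : R * R) (r : R), 0 < r ->
    (forall p, intersection_point p -> circle_interior c r p) ->
    (forall I, #|I| = k.+1 -> circle c r `&` l I !=set0) ->
    exists C : {set 'I_n} -> R * R,
      (forall I, #|I| = k.+1 -> right_endpoint c r (l I) (C I)) /\
      appear_clockwise c r C.

Definition lines_through p : {set {set 'I_n}} :=
  [set I : {set 'I_n} | (#|I| == k.+1) && `[< l I p >] ]%SET.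

(* p = P_{I|J}, lying on no further line *)
Definition double_point I J p : Prop :=
  l I `&` l J = [set p] /\ lines_through p = [set I; J]%SET.

(* p = P_L, lying on no further line *)
Definition multiple_point L p : Prop :=
  \bigcap_(i in [set i : 'I_n | i \in L]) l (L :\ i)%SET = [set p] /\
  lines_through p = [set (L :\ i)%SET | i in L]%SET.

Definition lexL2 : Prop :=
  [/\ forall I J, #|I| = k.+1 -> #|J| = k.+1 -> (#|I :&: J| < k)%N ->
        exists p, double_point I J p,
      forall L, #|L| = k.+2 -> exists p, multiple_point L p
    & forall p, intersection_point p ->
        (exists I J, [/\ #|I| = k.+1, #|J| = k.+1, (#|I :&: J| < k)%N
                       & double_point I J p]) \/
        (exists L, #|L| = k.+2 /\ multiple_point L p)].

Definition lexL3 : Prop :=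
  forall L L' p p', #|L| = k.+2 -> #|L'| = k.+2 ->
    multiple_point L p -> multiple_point L' p' ->
    lexlt L L' -> p'.1 < p.1.

Definition lexicographic_line_arrangement : Prop :=
  [/\ line_arrangement, lexL1, lexL2 & lexL3].

End Arrangement.

(* Main.v *)
Require Import Defs.
From mathcomp Require Import all_boot all_order all_algebra.
From mathcomp Require Import all_classical all_reals all_analysis.
From mathcomp Require Import polyrcf ring lra zify.

(** The lines are built from divided differences. Fix distinct nodes a_i and,
    for a function f on the indices, let f[I] be its divided difference on the
    nodes of I, that is the sum over i in I of f_i / prod_(j in I, j != i)
    (a_i - a_j). Given two functions f and g, take for l_I the line
    y = g[I] - f[I] x. The recursion f[L \ i] - f[L \ j] = (a_j - a_i) f[L]
    ([ddiff_exchange]), valid for f and for g, says that for a (k+2)-subset L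
    the k+2 lines l_(L \ i) pass through one point, of abscissa g[L] / f[L].
    It remains to choose a, f, g such that

    - f[I] increases with I in lexicographic order, so that slopes decrease
      and the right ends of the lines are met clockwise in that order;
    - g[L] / f[L] decreases with L in lexicographic order;
    - no three lines are concurrent except those dictated by some L.

    The first two points are obtained by adding the indices from the last one
    down to the first ([lex_configuration_extend]). For a new smallest index m,

      f[m, I] = (f_m - p_I(a_m)) / prod_(i in I) (a_m - a_i),

    where p_I is the polynomial interpolating f on I ([ddiffU1]). Take first
    a_m large, then a ratio K large, then t large, and put f_m = - t and
    g_m = - K t. Since t dominates, f[m, I] lies below all the previous values,
    and its dependence on I is governed by prod_(i in I) (a_m - a_i), hence for
    large a_m by the sum of the a_i over I, whose order is lexicographic because
    each node exceeds the sum of those following it. Likewise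

      g[m, L] / f[m, L] = K - (K p_L(a_m) - q_L(a_m)) / t + O(1 / t^2)

    (q_L interpolates g), which is above the previous ratios as K is large,
    and depends on L through p_L(a_m), hence, for large a_m, through its leading
    coefficient f[L], which is already known to be increasing.

    For the last point, the lines of I, J, K are concurrent only if g is a zero of
    a combination of the functionals g |-> g[I], g[J], g[K] whose three
    coefficients, differences of the numbers f[I], f[J], f[K], are nonzero.
    If I, J, K are not contained in a (k+2)-subset, these functionals are
    linearly independent provided the nodes avoid finitely many algebraic
    coincidences ([weights_independent]); those are avoided while choosing each
    a_m. A small perturbation of g then keeps all strict inequalities and moves g
    out of the zero sets of these finitely many nonzero functionals
    ([ddiff_realization]). *)

Set Implicit Arguments.
Unset Strict Implicit.
Unset Printing Implicit Defensive.

Import Order.TTheory GRing.Theory Num.Theory.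
Import numFieldNormedType.Exports.

Local Open Scope ring_scope.

(** * Sufficiently large values of a parameter *)

Section Eventually.
Variable R : realType.
Implicit Types (p : {poly R}) (x : R).

Lemma near_impl (b : bool) (P : R -> Prop) :
  (b -> \forall x \near +oo, P x) -> \forall x \near +oo, b -> P x.
Proof. by case: b => [/(_ isT)|_]; [apply: filterS|exact: filterE]. Qed.

Lemma near_all (I : finType) (P : I -> R -> Prop) :
  (forall i, \forall x \near +oo, P i x) ->
  \forall x \near +oo, forall i, P i x.
Proof. exact: filter_forall. Qed.

Lemma near_poly_gt0 p d : (size p <= d.+1)%N -> 0 < p`_d ->
  \forall x \near +oo, 0 < p.[x].
Proof.
move=> sp p_gt0.
have sz : size p = d.+1.
  apply/eqP; rewrite eqn_leq sp /=; case: ltnP => // /(nth_default 0) p0.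
  by rewrite p0 ltxx in p_gt0.
have lp : 0 < lead_coef p by rewrite /lead_coef sz.
have [M Mp] := poly_pinfty_gt_lc lp.
apply: filterS (nbhs_pinfty_ge (num_real M)) => x Mx.
exact: lt_le_trans lp (Mp _ Mx).
Qed.

Lemma near_poly_neq0 p : p != 0 -> \forall x \near +oo, p.[x] != 0.
Proof.
move=> p0; have sp : (size p <= (size p).-1.+1)%N by rewrite leqSpred.
have [lt0|gt0|/eqP] := ltgtP (lead_coef p) 0; last by rewrite lead_coef_eq0 (negPf p0).
  have spN : (size (- p) <= (size p).-1.+1)%N by rewrite size_polyN.
  have := near_poly_gt0 spN; rewrite coefN oppr_gt0 => /(_ lt0).
  by apply: filterS => x; rewrite hornerN oppr_gt0 => /ltr0_neq0.
by apply: filterS (near_poly_gt0 sp gt0) => x /lt0r_neq0.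
Qed.

Lemma near_affine_gt0 (u v : R) : 0 < u -> \forall x \near +oo, 0 < u * x + v.
Proof.
move=> u0; have := @near_poly_gt0 (u *: 'X + v%:P) 1.
rewrite coefD coefZ coefX coefC /= mulr1 addr0 => /(_ _ u0) H.
have {}H := H _; apply: filterS (H _) => [x|]; first by rewrite !hornerE.
apply: leq_trans (size_polyD _ _) _; rewrite geq_max size_polyC.
rewrite (leq_trans (size_scale_leq _ _)) ?size_polyX//.
by case: eqP.
Qed.

End Eventually.

(** * Lexicographic comparison of subsets *)

Section Precedes.
Variable n : nat.
Implicit Types (I J : {set 'I_n}) (i j : 'I_n).

(** The first element on which I and J differ belongs to I. For sets of the same
    size this is the lexicographic order; unlike [lexlt] it can be tested without
    listing elements, and it is compatible with the removal of a common one. *)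
Definition precedes I J :=
  [exists i, [&& i \in I, i \notin J &
     [forall j : 'I_n, (j < i)%N ==> ((j \in I) == (j \in J))]]].

Lemma precedesP I J :
  reflect (exists i, [/\ i \in I, i \notin J &
             forall j, (j < i)%N -> (j \in I) = (j \in J)])
          (precedes I J).
Proof.
apply: (iffP existsP) => -[i].
  by case/and3P=> iI iJ /forallP H; exists i; split=> // j ji; apply/eqP; exact: implyP (H j) ji.
case=> iI iJ H; exists i; rewrite iI iJ; apply/forallP=> j.
by apply/implyP=> ji; apply/eqP/H.
Qed.

(** Since both sequences increase, the first entry x in which they differ, being
    the smaller of the two, cannot occur in the other sequence, and the entries
    below x are common to both. *)
Lemma lexi_first_diff (s t : seq 'I_n) :
  sorted (fun i j : 'I_n => i < j)%N s -> sorted (fun i j : 'I_n => i < j)%N t ->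
  size s = size t -> ((s : seqlexi 'I_n) < (t : seqlexi 'I_n))%O ->
  exists i, [/\ i \in s, i \notin t &
             forall j, (j < i)%N -> (j \in s) = (j \in t)].
Proof.
have tr : transitive (fun i j : 'I_n => (i < j)%N) by move=> ? ? ?; exact: ltn_trans.
elim: s t => [|x s IH] [|y t] //= xs yt [] st.
rewrite Order.SeqLexiOrder.ltxi_cons.
have xsl := order_path_min tr xs; have ytl := order_path_min tr yt.
rewrite !leEord.
case: (ltngtP x y) => //= [xy _|/val_inj exy lt].
  have notin (z : 'I_n) (zy : (z < y)%N) : z \notin y :: t.
    rewrite inE negb_or; apply/andP; split; first by apply: contraTneq zy => ->; rewrite ltnn.
    by apply/negP=> /(allP ytl) /(ltn_trans zy); rewrite ltnn.
  exists x; split; [exact: mem_head|exact: notin|move=> j jx].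
  rewrite (negPf (notin _ (ltn_trans jx xy))); apply/negbTE.
  rewrite inE negb_or; apply/andP; split; first by apply: contraTneq jx => ->; rewrite ltnn.
  by apply/negP=> /(allP xsl) /(ltn_trans jx); rewrite ltnn.
subst y; have [i [is_ it H]] := IH _ (path_sorted xs) (path_sorted yt) st lt.
exists i; split; first by rewrite inE is_ orbT.
  rewrite inE negb_or it andbT; apply: contraTneq (allP xsl _ is_) => ->.
  by rewrite ltnn.
by move=> j ji; rewrite !inE H.
Qed.

Lemma enum_set_sorted I : sorted (fun i j : 'I_n => i < j)%N (enum I).
Proof.
have tr : transitive (fun i j : 'I_n => (i < j)%N) by move=> ? ? ?; exact: ltn_trans.
rewrite /enum_mem; apply: sorted_filter => //.
rewrite -enumT -(@sorted_map _ _ val ltn) val_enum_ord.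
exact: iota_ltn_sorted.
Qed.

Lemma lexlt_precedes I J : #|I| = #|J| -> lexlt I J -> precedes I J.
Proof.
rewrite !cardE => cIJ /(lexi_first_diff (enum_set_sorted I) (enum_set_sorted J) cIJ).
case=> i []; rewrite !mem_enum => iI iJ H; apply/precedesP; exists i; split=> // j /H.
by rewrite !mem_enum.
Qed.

Lemma precedes_total I J : I != J -> precedes I J || precedes J I.
Proof.
move=> neq; have [x xD] : exists x, (x \in I) != (x \in J).
  apply/existsP; apply: contraR neq => /existsPn H; apply/eqP/setP=> x.
  by apply/eqP; have := H x; rewrite negbK.
case: (@arg_minnP _ x (fun x => (x \in I) != (x \in J)) val xD) => i iD imin.
have agree j : (j < i)%N -> (j \in I) = (j \in J).
  by move=> ji; apply/eqP; apply: contraTT ji => /imin; rewrite -leqNgt.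
apply/orP; case iI : (i \in I) iD => iD; [left|right]; apply/precedesP; exists i.
  by rewrite iI; split=> //; case: (i \in J) iD.
by rewrite iI; split=> //; [case: (i \in J) iD|move=> j /agree].
Qed.

Lemma precedesD1 (m : 'I_n) I J : m \in I -> m \in J ->
  precedes I J -> precedes (I :\ m) (J :\ m).
Proof.
move=> mI mJ /precedesP[i [iI iJ H]]; apply/precedesP; exists i.
have im : i != m by apply: contraNneq iJ => ->.
rewrite !inE im iI (negPf iJ); split=> // j /H jIJ.
by rewrite !inE jIJ.
Qed.

End Precedes.

(** * Divided differences *)

Section DividedDifferences.
Variables (F : fieldType) (T : finType).
Implicit Types (a f g : T -> F) (I J L : {set T}) (i j m : T) (x : F).

Definition nodal a I : {poly F} := \prod_(i in I) ('X - (a i)%:P).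

Lemma horner_nodal a I x : (nodal a I).[x] = \prod_(i in I) (x - a i).
Proof. by rewrite horner_prod; apply: eq_bigr => i _; rewrite !hornerE. Qed.

Lemma nodal_eq0 a I x : ((nodal a I).[x] == 0) = [exists i in I, x == a i].
Proof.
rewrite horner_nodal; apply/prodf_eq0/existsP.
  by case=> i iI; rewrite subr_eq0 => ?; exists i; rewrite iI.
by case=> i /andP[iI xi]; exists i; rewrite // subr_eq0.
Qed.

Lemma nodal_neq0 a I i : {in i |: I &, injective a} -> i \notin I ->
  (nodal a I).[a i] != 0.
Proof.
move=> a_inj iI; rewrite nodal_eq0; apply/existsPn => j; apply/negP=> /andP[jI /eqP].
move/a_inj; rewrite !inE eqxx jI orbT => /(_ isT isT) ij.
by rewrite ij jI in iI.
Qed.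

Lemma nodalU1 a I m x : m \notin I ->
  (nodal a (m |: I)).[x] = (x - a m) * (nodal a I).[x].
Proof. by move=> mI; rewrite !horner_nodal big_setU1. Qed.

Lemma nodalD1 a I m x : m \in I ->
  (nodal a I).[x] = (x - a m) * (nodal a (I :\ m)).[x].
Proof. by move=> mI; rewrite -[in LHS](finset.setD1K mI) nodalU1 // !inE eqxx. Qed.

Lemma nodalID a I J x :
  (nodal a I).[x] = (nodal a (I :&: J)).[x] * (nodal a (I :\: J)).[x].
Proof. by rewrite !horner_nodal (big_setID J). Qed.

Lemma size_nodal a I : size (nodal a I) = #|I|.+1.
Proof. by rewrite /nodal -big_enum /= size_prod_XsubC -cardE. Qed.

(** The coefficient of f_i in the divided difference f[I]. It is extended by zero
    outside I, so that all divided differences become linear forms in the same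
    variables. *)
Definition weight a I i := if i \in I then (nodal a (I :\ i)).[a i]^-1 else 0.

Definition ddiff a f I := \sum_i f i * weight a I i.

(** Lagrange's polynomial interpolating f on the nodes of I. *)
Definition interp a f I : {poly F} :=
  \sum_i (f i * weight a I i) *: nodal a (I :\ i).

Lemma size_interp a f I : (size (interp a f I) <= #|I|)%N.
Proof.
apply: leq_trans (size_sum _ _ _) _; apply/bigmax_leqP => i _.
have [iI|iI] := boolP (i \in I).
  by rewrite (leq_trans (size_scale_leq _ _)) // size_nodal (cardsD1 i I) iI.
by rewrite /weight (negPf iI) mulr0 scale0r size_poly0.
Qed.

Lemma monic_nodal a I : nodal a I \is monic.
Proof. exact: monic_prod_XsubC. Qed.

Lemma coef_nodal a I : (nodal a I)`_#|I| = 1.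
Proof. by have /monicP := monic_nodal a I; rewrite /lead_coef size_nodal. Qed.

(** Each basis polynomial is monic of degree #|I| - 1. *)
Lemma coef_interp a f I d : #|I| = d.+1 -> (interp a f I)`_d = ddiff a f I.
Proof.
move=> cI; rewrite coef_sum; apply: eq_bigr => i _; rewrite coefZ.
have [iI|iI] := boolP (i \in I); last by rewrite /weight (negPf iI) mulr0 mul0r.
have -> : d = #|I :\ i| by move: cI; rewrite (cardsD1 i) iI => -[].
by rewrite coef_nodal mulr1.
Qed.

Lemma weight_neq0 a I i : {in I &, injective a} -> i \in I -> weight a I i != 0.
Proof.
move=> a_inj iI; rewrite /weight iI invr_eq0 nodal_neq0 ?finset.setD1K //.
by rewrite !inE eqxx.
Qed.

(** Removing a node m cancels the factor a_i - a_m in the denominator; both sides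
    vanish for i = m. The two identities on divided differences below follow
    from this one. *)
Lemma weightD1 a I i m : {in I &, injective a} -> m \in I ->
  weight a (I :\ m) i = weight a I i * (a i - a m).
Proof.
move=> a_inj mI; rewrite /weight !inE.
have [->|im] := eqVneq i m; first by rewrite subrr mulr0.
have [iI|iI] := boolP (i \in I); last by rewrite mul0r.
have mIi : m \in I :\ i by rewrite !inE mI eq_sym im.
rewrite (nodalD1 _ _ mIi) finset.setDDl finset.setUC -finset.setDDl.
have aim : a i - a m != 0 by rewrite subr_eq0; apply: contraNneq im => /a_inj->.
by rewrite invfM mulrAC mulVf // mul1r.
Qed.

(** This identity makes the lines of the sets L \ i concurrent. *)
Lemma ddiff_exchange a f I i j : {in I &, injective a} -> i \in I -> j \in I ->
  ddiff a f (I :\ i) - ddiff a f (I :\ j) = (a j - a i) * ddiff a f I.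
Proof.
move=> a_inj iI jI; rewrite /ddiff -sumrB mulr_sumr; apply: eq_bigr => r _.
by rewrite !weightD1 //; ring.
Qed.

(** The divided difference compares the value at the new node with the one
    predicted by interpolation on the others. It isolates the dependence on the
    value of f at m. *)
Lemma ddiffU1 a f I m : {in m |: I &, injective a} -> m \notin I ->
  ddiff a f (m |: I) = (f m - (interp a f I).[a m]) / (nodal a I).[a m].
Proof.
move=> a_inj mI; rewrite mulrBl /ddiff (bigD1 m) //=; congr (_ + _).
  by rewrite /weight finset.setU11 finset.setU1K.
rewrite horner_sum mulr_suml -sumrN [RHS](bigD1 m) //=.
rewrite [X in X + _](_ : _ = 0) ?add0r; last first.
  by rewrite /weight (negPf mI) mulr0 scale0r horner0 mul0r oppr0.
apply: eq_bigr => i im; rewrite hornerZ.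
have -> : weight a I i = weight a (m |: I) i * (a i - a m).
  by rewrite -weightD1 ?finset.setU11 // finset.setU1K.
have [iI|iI] := boolP (i \in m |: I); last first.
  by rewrite /weight (negPf iI) !(mul0r, mulr0, oppr0).
have {}iI : i \in I by move: iI; rewrite !inE (negPf im).
rewrite (nodalD1 _ _ iI).
have N0 : (nodal a (I :\ i)).[a m] != 0.
  apply: nodal_neq0; last by rewrite !inE negb_and mI orbT.
  by apply: sub_in2 a_inj => z; rewrite !inE => /orP[->//|/andP[_ ->]]; rewrite orbT.
have a0 : a m - a i != 0.
  by rewrite subr_eq0; apply: contraNneq im => /a_inj ->; rewrite ?inE ?eqxx ?iI ?orbT.
by field; rewrite N0 a0.
Qed.

Lemma eq_nodal a a' I : {in I, a =1 a'} -> nodal a I = nodal a' I.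
Proof. by move=> aa'; apply: eq_bigr => i /aa' ->. Qed.

Lemma eq_weight a a' I : {in I, a =1 a'} -> weight a I =1 weight a' I.
Proof.
move=> aa' i; rewrite /weight; case: ifP => // iI.
by rewrite aa' // (@eq_nodal a a') // => j; rewrite !inE => /andP[_ /aa'].
Qed.

Lemma eq_ddiff a a' f f' I : {in I, a =1 a'} -> {in I, f =1 f'} ->
  ddiff a f I = ddiff a' f' I.
Proof.
move=> aa' ff'; apply: eq_bigr => i _; rewrite (eq_weight aa').
have [/ff' -> //|iI] := boolP (i \in I).
by rewrite /weight (negPf iI) !mulr0.
Qed.

Lemma eq_interp a a' f f' I : {in I, a =1 a'} -> {in I, f =1 f'} ->
  interp a f I = interp a' f' I.
Proof.
move=> aa' ff'; apply: eq_bigr => i _; rewrite (eq_weight aa').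
rewrite (@eq_nodal a a') => [|j]; last by rewrite !inE => /andP[_ /aa'].
have [/ff' -> //|iI] := boolP (i \in I).
by rewrite /weight (negPf iI) !mulr0.
Qed.

End DividedDifferences.

(** * Interpolation far from the nodes *)

Section NearNodal.
Variables (R : realType) (T : finType).
Implicit Types (a f : T -> R) (I J : {set T}).

Lemma coefPn_nodal a I d : #|I| = d.+1 -> (nodal a I)`_d = - \sum_(i in I) a i.
Proof.
move=> cI; have sz : size [seq a i | i <- enum I] = d.+1 by rewrite size_map -cardE.
have := @coefPn_prod_XsubC R [seq a i | i <- enum I].
by rewrite sz => /(_ isT) /=; rewrite !big_map !big_enum.
Qed.

Lemma near_nodal_gt0 a I : \forall x \near +oo, 0 < (nodal a I).[x].
Proof. by apply: (@near_poly_gt0 _ _ #|I|); rewrite ?size_nodal ?coef_nodal. Qed.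

(** The two monic polynomials have the same degree and their next coefficients are
    minus the sums of the nodes. *)
Lemma near_nodal_lt a I J : (0 < #|I|)%N -> #|I| = #|J| ->
  \sum_(i in J) a i < \sum_(i in I) a i ->
  \forall x \near +oo, (nodal a I).[x] < (nodal a J).[x].
Proof.
case cI : #|I| => [//|d] _ /esym cJ lt_sum.
have sz : (size (nodal a J - nodal a I)%R <= d.+1)%N.
  apply/leq_sizeP => e; rewrite leq_eqVlt => /predU1P[<-|de].
    by rewrite coefB -{1}cJ -{1}cI !coef_nodal subrr.
  by rewrite coefB !nth_default ?subrr // size_nodal ?cI ?cJ.
have co : 0 < (nodal a J - nodal a I)`_d.
  by rewrite coefB !(coefPn_nodal a (d := d)) // opprK addrC subr_gt0.
apply: filterS (near_poly_gt0 sz co) => x.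
by rewrite hornerD hornerN subr_gt0.
Qed.

(** The divided difference is the leading coefficient of the interpolant. *)
Lemma near_interp_lt a f I J : (0 < #|I|)%N -> #|I| = #|J| ->
  ddiff a f I < ddiff a f J ->
  \forall x \near +oo, (interp a f I).[x] < (interp a f J).[x].
Proof.
case cI : #|I| => [//|d] _ /esym cJ lt_dd.
have sz : (size (interp a f J - interp a f I)%R <= d.+1)%N.
  apply: leq_trans (size_polyD _ _) _; rewrite geq_max size_polyN.
  by rewrite -{1}cJ -{1}cI !size_interp.
have co : 0 < (interp a f J - interp a f I)`_d.
  by rewrite coefB !coef_interp // subr_gt0.
apply: filterS (near_poly_gt0 sz co) => x.
by rewrite hornerD hornerN subr_gt0.
Qed.

End NearNodal.

(** * Lacunary nodes and lexicographic configurations *)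

Section Configuration.
Variables (R : realType) (n : nat).
Implicit Types (a f g : 'I_n -> R) (I J L A B : {set 'I_n}) (j : nat).

(** Indices are added in decreasing order, so that the sets treated so far are the
    subsets of some [upper j]. *)
Definition upper j : {set 'I_n} := [set i : 'I_n | (j <= i)%N].

(** This growth makes sums of nodes over sets of indices follow the lexicographic
    order, as binary expansions do. *)
Definition lacunary a j := forall i : 'I_n, (j <= i)%N ->
  0 < a i /\ \sum_(l < n | (i < l)%N) a l < a i.

(** The coincidences that the nodes have to avoid: the rational function
    nodal A / nodal B never takes the same value at a_m and at a_c. Only sets
    following m are involved, so that this can be ensured when a_m is chosen. *)
Definition cross_generic a j := forall (m c : 'I_n) A B, (j <= m)%N ->
  c |: (A :|: B) \subset upper m.+1 -> A != finset.set0 -> [disjoint A & B] ->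
  c \notin A :|: B ->
  (nodal a A).[a m] * (nodal a B).[a c] != (nodal a A).[a c] * (nodal a B).[a m].

Definition lex_increasing k a f j := forall I J,
  I \subset upper j -> J \subset upper j -> #|I| = k.+1 -> #|J| = k.+1 ->
  precedes I J -> ddiff a f I < ddiff a f J.

(** The ratio g[L] / f[L] decreases, stated after clearing the denominators, which
    have the same sign; in this form the condition is linear in g. *)
Definition lex_decreasing_ratio k a f g j := forall L L',
  L \subset upper j -> L' \subset upper j -> #|L| = k.+2 -> #|L'| = k.+2 ->
  precedes L L' -> ddiff a g L' * ddiff a f L < ddiff a g L * ddiff a f L'.

Lemma lacunary_lt a j (i l : 'I_n) : lacunary a j -> (j <= i)%N -> (i < l)%N ->
  a l < a i.
Proof.
move=> la ji il; have [_] := la _ ji; apply: le_lt_trans.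
rewrite (bigD1 l) //= lerDl; apply: sumr_ge0 => x /andP[ix _].
by have [/ltW] := la x (leq_trans ji (ltnW ix)).
Qed.

Lemma lacunary_inj a j I : lacunary a j -> I \subset upper j ->
  {in I &, injective a}.
Proof.
move=> la /fintype.subsetP Ij x y /Ij + /Ij; rewrite !inE => jx jy axy.
apply/val_inj; have [xy|yx|//] := ltngtP x y.
  by have := lacunary_lt la jx xy; rewrite axy ltxx.
by have := lacunary_lt la jy yx; rewrite axy ltxx.
Qed.

Lemma lacunary_sum_lt a j I J : lacunary a j ->
  I \subset upper j -> J \subset upper j -> precedes I J ->
  \sum_(i in J) a i < \sum_(i in I) a i.
Proof.
move=> la /fintype.subsetP Ij /fintype.subsetP Jj /precedesP[i [iI iJ agree]].
have ji : (j <= i)%N by have := Ij _ iI; rewrite inE.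
rewrite (bigID (fun x : 'I_n => x < i)%N) /= [ltRHS](bigID (fun x : 'I_n => x < i)%N) /=.
apply: ler_ltD.
  rewrite le_eqVlt; apply/orP; left; apply/eqP; apply: eq_bigl => x.
  by case: ltnP => [/agree ->|]; rewrite ?andbF.
have -> : \sum_(x in J | ~~ (x < i)%N) a x = \sum_(x in J | (i < x)%N) a x.
  apply: eq_bigl => x; rewrite -leqNgt leq_eqVlt.
  by case: (eqVneq (i : nat) x) => [/val_inj <-|//]; rewrite (negPf iJ).
have [_ H] := la _ ji; apply: (@le_lt_trans _ _ (\sum_(l < n | (i < l)%N) a l)).
  rewrite [leRHS](bigID (mem J)) /= (eq_bigl (fun x : 'I_n => (i < x)%N && (x \in J))).
    rewrite lerDl; apply: sumr_ge0 => x /andP[ix _].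
    by have [/ltW] := la x (leq_trans ji (ltnW ix)).
  by move=> x; rewrite andbC.
apply: (lt_le_trans H); rewrite (bigD1 i) /= ?iI ?ltnn // lerDl.
apply: sumr_ge0 => x /andP[/andP[xI _] _].
by have := Ij _ xI; rewrite inE => /la[/ltW].
Qed.

Lemma precedes_exchange L (i l : 'I_n) : i \in L -> (i < l)%N ->
  precedes (L :\ l) (L :\ i).
Proof.
move=> iL il; apply/precedesP; exists i; rewrite !inE eqxx iL andbT.
split=> // [|x xi]; first by apply: contraTneq il => ->; rewrite ltnn.
rewrite !inE; have -> : x != l by apply: contraTneq xi => ->; rewrite -leqNgt ltnW.
by have -> : x != i by apply: contraTneq xi => ->; rewrite ltnn.
Qed.

(** For i < j in L, the set L \ j precedes L \ i while a_j < a_i, and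
    f[L \ i] - f[L \ j] = (a_j - a_i) f[L]. *)
Lemma lex_increasing_ddiff_lt0 k a f j L : lacunary a j -> lex_increasing k a f j ->
  L \subset upper j -> #|L| = k.+2 -> ddiff a f L < 0.
Proof.
move=> la incr Lj cL.
have /card_gt1P[x [y [xL yL xy]]] : (1 < #|L|)%N by rewrite cL.
wlog lt_xy : x y xL yL xy / (x < y)%N.
  move=> H; have [|yx|/val_inj] := ltngtP x y; [exact: H| |by move/eqP; rewrite (negPf xy)].
  by apply: H yx => //; rewrite eq_sym.
have card i : i \in L -> #|L :\ i| = k.+1.
  by move=> iL; move: cL; rewrite (cardsD1 i) iL => -[].
have sub i : L :\ i \subset upper j by rewrite (fintype.subset_trans (subsetDl _ _)).
have := incr _ _ (sub y) (sub x) (card _ yL) (card _ xL) (precedes_exchange xL lt_xy).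
rewrite -subr_gt0 (ddiff_exchange f (lacunary_inj la Lj) xL yL) => H.
have ax : a y - a x < 0.
  rewrite subr_lt0; apply: lacunary_lt la _ lt_xy.
  by have := fintype.subsetP Lj _ xL; rewrite inE.
by move: H; rewrite nmulr_rgt0.
Qed.

End Configuration.

(** * Adding an index *)

Section Extension.
Variables (R : realType) (n : nat).
Implicit Types (a f g : 'I_n -> R) (I J L A B : {set 'I_n}).

Definition update f (m : 'I_n) (x : R) (i : 'I_n) : R := if i == m then x else f i.

Lemma update_eq f m x : update f m x m = x.
Proof. by rewrite /update eqxx. Qed.

Lemma update_neq f m x i : i != m -> update f m x i = f i.
Proof. by rewrite /update => /negPf->. Qed.

Lemma update_on f m x I : m \notin I -> {in I, update f m x =1 f}.
Proof. by move=> mI i iI; apply: update_neq; apply: contraNneq mI => <-. Qed.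

Lemma notin_upperS (m : 'I_n) I : I \subset upper n m.+1 -> m \notin I.
Proof. by move=> /fintype.subsetP H; apply/negP => /H; rewrite inE ltnn. Qed.

Lemma upperD1 (m : 'I_n) I : I \subset upper n m -> I :\ m \subset upper n m.+1.
Proof.
move=> /fintype.subsetP H; apply/fintype.subsetP=> x; rewrite !inE => /andP[xm /H].
by rewrite inE leq_eqVlt => /predU1P[/val_inj mx|//]; rewrite mx eqxx in xm.
Qed.

Lemma upperS_notin (m : 'I_n) I : I \subset upper n m -> m \notin I ->
  I \subset upper n m.+1.
Proof. by move=> /upperD1 + mI; rewrite (finset.setDidPl _) // disjoint_sym disjoints1. Qed.

Lemma lacunary_update a (m : 'I_n) x : lacunary a m.+1 ->
  0 < x -> \sum_(l < n | (m < l)%N) a l < x -> lacunary (update a m x) m.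
Proof.
move=> la x0 sx i mi.
have -> : \sum_(l < n | (i < l)%N) update a m x l = \sum_(l < n | (i < l)%N) a l.
  apply: eq_bigr => l il; apply: update_neq.
  by apply: contraTneq il => ->; rewrite -leqNgt.
have [->|im] := eqVneq i m; first by rewrite update_eq.
rewrite update_neq //; apply: la; rewrite ltn_neqAle mi andbT.
by apply: contraNneq im => /val_inj->.
Qed.

(** For given c, A and B, the condition excludes the roots of a polynomial in the
    new node, which is nonzero since it does not vanish at the nodes of A. *)
Lemma near_cross_generic a (m : 'I_n) : lacunary a m.+1 -> cross_generic a m.+1 ->
  \forall x \near +oo, cross_generic (update a m x) m.
Proof.
move=> la ga.
pose cond c A B := [&& c |: (A :|: B) \subset upper n m.+1, A != finset.set0,
  [disjoint A & B] & c \notin A :|: B].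
pose P x := forall c A B, cond c A B ->
  (nodal a A).[x] * (nodal a B).[a c] != (nodal a A).[a c] * (nodal a B).[x].
have : \forall x \near +oo, P x.
  apply: near_all => c; apply: near_all => A; apply: near_all => B.
  apply: near_impl => /and4P[sub /finset.set0Pn[y yA] dis cAB].
  pose p := (nodal a B).[a c] *: nodal a A - (nodal a A).[a c] *: nodal a B.
  have inj := lacunary_inj la sub.
  have p0 : p != 0.
    apply/eqP => p0; have : p.[a y] = 0 by rewrite p0 horner0.
    rewrite !hornerE.
    have -> : (nodal a A).[a y] = 0.
      by apply/eqP; rewrite nodal_eq0; apply/existsP; exists y; rewrite yA eqxx.
    rewrite mulr0 sub0r => /eqP; rewrite oppr_eq0 mulf_eq0; apply/negP.
    rewrite negb_or !nodal_neq0 //; first last.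
    - by apply: contraNN cAB => cA; rewrite inE cA.
    - by apply: sub_in2 inj => z; rewrite !inE => /orP[->|->] //; rewrite orbT.
    - by rewrite (disjointFr dis yA).
    by apply: sub_in2 inj => z; rewrite !inE => /orP[/eqP->|->]; rewrite ?yA !orbT.
  apply: filterS (near_poly_neq0 p0) => x.
  by rewrite !hornerE subr_eq0 mulrC.
apply: filterS => x Px m' c A B mm' sub A0 dis cAB.
have [eqm|neqm] := eqVneq m' m.
  subst m'; have mn := notin_upperS sub.
  have [mA mB] : m \notin A /\ m \notin B.
    by split; apply: contraNN mn => mX; rewrite !inE mX !orbT.
  rewrite update_eq !(eq_nodal (update_on _ _ mA), eq_nodal (update_on _ _ mB)).
  rewrite update_neq; last by apply: contraNneq mn => ->; rewrite !inE eqxx.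
  by apply: Px; apply/and4P.
have lt : (m < m')%N.
  by rewrite ltn_neqAle mm' andbT; apply: contraNneq neqm => /val_inj ->.
have mn : m \notin c |: (A :|: B).
  by apply/negP=> /(fintype.subsetP sub); rewrite inE ltnNge ltnW.
have [mA mB] : m \notin A /\ m \notin B.
  by split; apply: contraNN mn => mX; rewrite !inE mX !orbT.
rewrite !(eq_nodal (update_on _ _ mA), eq_nodal (update_on _ _ mB)).
rewrite !update_neq //; last by apply: contraNneq mn => ->; rewrite !inE eqxx.
exact: ga.
Qed.

Lemma ddiff_update_notin a f m x y I : m \notin I ->
  ddiff (update a m x) (update f m y) I = ddiff a f I.
Proof. by move=> mI; apply: eq_ddiff; exact: update_on. Qed.

Lemma ddiff_update_in a f m x y I : {in I &, injective (update a m x)} -> m \in I ->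
  ddiff (update a m x) (update f m y) I =
  (y - (interp a f (I :\ m)).[x]) / (nodal a (I :\ m)).[x].
Proof.
move=> inj mI; have mIm : m \notin I :\ m by rewrite !inE eqxx.
rewrite -{1}(finset.setD1K mI) ddiffU1 ?finset.setD1K // !update_eq.
rewrite (eq_interp (update_on _ _ mIm) (update_on _ _ mIm)).
by rewrite (eq_nodal (update_on _ _ mIm)).
Qed.

Definition lex_configuration k a f g j := [/\ lacunary a j, cross_generic a j,
  lex_increasing k a f j & lex_decreasing_ratio k a f g j].

(** The new node x, the ratio K and the size t are chosen in this order, each large
    compared with what precedes. Every inequality to be satisfied is then, up to
    positive denominators, affine in the parameter being chosen, or polynomial in x,
    with a leading coefficient whose sign was settled at the previous choice. *)
Lemma lex_configuration_extend k (m : 'I_n) a f g : (0 < k)%N -> lex_configuration k a f g m.+1 ->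
  exists a' f' g', lex_configuration k a' f' g' m.
Proof.
move=> k0 [la ga incr ratio].
pose U := upper n m.+1.
pose cond d I J := [&& I \subset U, J \subset U, #|I| == d, #|J| == d & precedes I J].
have near_node : \forall x \near +oo,
   [/\ 0 < x /\ \sum_(l < n | (m < l)%N) a l < x,
       cross_generic (update a m x) m,
       forall I, 0 < (nodal a I).[x],
       forall I J, cond k I J -> (nodal a I).[x] < (nodal a J).[x]
     & forall I J, cond k.+1 I J -> (interp a f I).[x] < (interp a f J).[x] ].
  near=> x; split.
  - by split; near: x; apply: nbhs_pinfty_gt; exact: num_real.
  - by near: x; exact: near_cross_generic.
  - by near: x; apply: near_all => I; exact: near_nodal_gt0.
  - near: x; apply: near_all => I; apply: near_all => J; apply: near_impl.
    case/and5P=> IU JU /eqP cI /eqP cJ IJ; apply: near_nodal_lt; rewrite ?cI ?cJ //.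
    exact: lacunary_sum_lt la IU JU IJ.
  - near: x; apply: near_all => I; apply: near_all => J; apply: near_impl.
    case/and5P=> IU JU /eqP cI /eqP cJ IJ; apply: near_interp_lt; rewrite ?cI ?cJ //.
    exact: incr.
have [x [[x0 sx] gx npos nlt ilt]] := filter_ex near_node.
have near_ratio : \forall K \near +oo,
   (forall I J, cond k.+1 I J -> K * (interp a f I).[x] - (interp a g I).[x] <
       K * (interp a f J).[x] - (interp a g J).[x]) /\
   (forall L, (L \subset U) && (#|L| == k.+2) -> K * ddiff a f L < ddiff a g L).
  near=> K; split.
  - near: K; apply: near_all => I; apply: near_all => J; apply: near_impl => /ilt.
    rewrite -subr_gt0 => /(near_affine_gt0 ((interp a g I).[x] - (interp a g J).[x])).
    by apply: filterS => K; lra.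
  - near: K; apply: near_all => L; apply: near_impl => /andP[LU /eqP cL].
    have := lex_increasing_ddiff_lt0 la incr LU cL; rewrite -oppr_gt0.
    move=> /(near_affine_gt0 (ddiff a g L)).
    by apply: filterS => K; lra.
have [K [K1 K2]] := filter_ex near_ratio.
have near_size : \forall t \near +oo,
   [/\ forall I J, cond k I J ->
         (t + (interp a f J).[x]) * (nodal a I).[x] <
         (t + (interp a f I).[x]) * (nodal a J).[x],
       forall I J, - t - (interp a f I).[x] < ddiff a f J * (nodal a I).[x],
       forall I J, cond k.+1 I J ->
         (K * t + (interp a g J).[x]) * (t + (interp a f I).[x]) <
         (K * t + (interp a g I).[x]) * (t + (interp a f J).[x])
     & forall I L, (L \subset U) && (#|L| == k.+2) ->
         (K * t + (interp a g I).[x]) * ddiff a f L <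
         ddiff a g L * (t + (interp a f I).[x])].
  near=> t; split.
  - near: t; apply: near_all => I; apply: near_all => J; apply: near_impl => /nlt.
    rewrite -subr_gt0 => /(near_affine_gt0 ((interp a f I).[x] * (nodal a J).[x] -
      (interp a f J).[x] * (nodal a I).[x])).
    by apply: filterS => t; lra.
  - near: t; apply: near_all => I; apply: near_all => J.
    apply: filterS (near_affine_gt0 ((interp a f I).[x] +
      ddiff a f J * (nodal a I).[x]) ltr01) => t; lra.
  - near: t; apply: near_all => I; apply: near_all => J; apply: near_impl => /K1.
    rewrite -subr_gt0 => /(near_affine_gt0 ((interp a g I).[x] * (interp a f J).[x] -
      (interp a g J).[x] * (interp a f I).[x])).
    by apply: filterS => t; lra.
  - near: t; apply: near_all => I; apply: near_all => L; apply: near_impl => /K2.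
    rewrite -subr_gt0 => /(near_affine_gt0 (ddiff a g L * (interp a f I).[x] -
      (interp a g I).[x] * ddiff a f L)).
    by apply: filterS => t; lra.
have [t [t1 t2 t3 t4]] := filter_ex near_size.
have la' := lacunary_update la x0 sx.
have card d I : m \in I -> #|I| = d.+1 -> #|I :\ m| = d.
  by move=> mI; rewrite (cardsD1 m) mI => -[].
have condD1 d I J : I \subset upper n m -> J \subset upper n m ->
    #|I| = d.+1 -> #|J| = d.+1 -> precedes I J -> m \in I -> m \in J ->
    cond d (I :\ m) (J :\ m).
  move=> Im Jm cI cJ IJ mI mJ; apply/and5P; split; rewrite ?upperD1 ?(card d) //.
  exact: precedesD1.
exists (update a m x), (update f m (- t)), (update g m (- (K * t))); split => //.
- move=> I J Im Jm cI cJ IJ.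
  have injI := lacunary_inj la' Im; have injJ := lacunary_inj la' Jm.
  have [mI|mI] := boolP (m \in I); have [mJ|mJ] := boolP (m \in J).
  + rewrite !ddiff_update_in // ltr_pdivrMr // mulrAC ltr_pdivlMr //.
    have := t1 _ _ (condD1 _ _ _ Im Jm cI cJ IJ mI mJ); lra.
  + by rewrite ddiff_update_in // ddiff_update_notin // ltr_pdivrMr.
  (* As m is the least index of [upper n m], J would precede I. *)
  + move: IJ => /precedesP[i [iI _ agree]].
    have := agree m; rewrite mJ (negPf mI); case: (ltngtP m i) => [_ /(_ isT)//|im _|/val_inj mi].
      have := fintype.subsetP Im _ iI; rewrite inE leqNgt => /negP; by case.
    by rewrite mi iI in mI.
  + by rewrite !ddiff_update_notin //; apply: incr; rewrite ?upperS_notin.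
- move=> I J Im Jm cI cJ IJ.
  have injI := lacunary_inj la' Im; have injJ := lacunary_inj la' Jm.
  have [mI|mI] := boolP (m \in I); have [mJ|mJ] := boolP (m \in J).
  + rewrite !ddiff_update_in // !mulf_div [X in _ < _ / X]mulrC.
    rewrite ltr_pM2r ?invr_gt0 ?mulr_gt0 //.
    have := t3 _ _ (condD1 _ _ _ Im Jm cI cJ IJ mI mJ); lra.
  + rewrite !(ddiff_update_in _ _ injI mI) !(ddiff_update_notin _ _ _ _ mJ).
    rewrite mulrA [X in _ < X]mulrAC.
    rewrite ltr_pM2r ?invr_gt0 //.
    have := t4 (I :\ m) J; rewrite cJ eqxx upperS_notin // => /(_ isT); lra.
  + move: IJ => /precedesP[i [iI _ agree]].
    have := agree m; rewrite mJ (negPf mI); case: (ltngtP m i) => [_ /(_ isT)//|im _|/val_inj mi].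
      have := fintype.subsetP Im _ iI; rewrite inE leqNgt => /negP; by case.
    by rewrite mi iI in mI.
  + by rewrite !ddiff_update_notin //; apply: ratio; rewrite ?upperS_notin.
Unshelve. all: by end_near.
Qed.

Lemma lex_configuration_exists k : (0 < k)%N -> exists a f g, lex_configuration k a f g 0.
Proof.
move=> k0; suff H d : (d <= n)%N -> exists a f g, lex_configuration k a f g (n - d).
  by have := H n (leqnn n); rewrite subnn.
elim: d => [_|d IH dn].
  have empty I d : I \subset upper n (n - 0) -> #|I| <> d.+1.
    move=> In; have := fintype.subset_leq_card In; rewrite (_ : upper n _ = finset.set0).
      by rewrite cards0 leqn0 => /eqP->.
    by apply/finset.setP=> i; rewrite !inE subn0 leqNgt ltn_ord.
  exists (fun=> 0), (fun=> 0), (fun=> 0); split.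
  - by move=> i; rewrite subn0 leqNgt ltn_ord.
  - by move=> m c A B; rewrite subn0 leqNgt ltn_ord.
  - by move=> I J /empty cI _ /cI.
  - by move=> I J /empty cI _ /cI.
have [a [f [g]]] := IH (ltnW dn).
have lt : (n - d.+1 < n)%N by rewrite ltn_subrL /= (leq_ltn_trans _ dn).
rewrite (_ : n - d = (Ordinal lt).+1)%N; first by move=> /(lex_configuration_extend k0).
by rewrite /= subnSK.
Qed.

End Extension.

(** * Independence of divided differences *)

Section Independence.
Variables (R : realType) (n k : nat) (a : 'I_n -> R).
Hypotheses (a_inj : injective a) (a_gen : cross_generic a 0).
Implicit Types (I J K U : {set 'I_n}) (al be ga : R).

(** The nodes of I :&: J contribute the same factor to both weights. *)
Lemma weight_pair_eq0 I J al be x : x \in I -> x \in J ->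
  al * weight a I x + be * weight a J x = 0 ->
  al * (nodal a (J :\: I)).[a x] + be * (nodal a (I :\: J)).[a x] = 0.
Proof.
move=> xI xJ; rewrite /weight xI xJ.
have split (X Y : {set _}) : x \in Y -> (nodal a (X :\ x)).[a x] =
    (nodal a ((X :&: Y) :\ x)).[a x] * (nodal a (X :\: Y)).[a x].
  move=> xY; rewrite (nodalID a (X :\ x) Y); congr (_.[_] * _.[_]); congr (nodal _ _).
    by apply/finset.setP=> z; rewrite !inE; case: (z == x).
  by apply/finset.setP=> z; rewrite !inE; case: eqVneq => // ->; rewrite xY.
rewrite (split I J xJ) (split J I xI) (finset.setIC J I) !invfM.
have node0 (X : {set _}) : x \notin X -> (nodal a X).[a x] != 0.
  by move=> xX; apply: nodal_neq0 => // u v _ _; exact: a_inj.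
have [N0 P0 Q0] : [/\ (nodal a ((I :&: J) :\ x)).[a x] != 0,
    (nodal a (I :\: J)).[a x] != 0 & (nodal a (J :\: I)).[a x] != 0].
  by split; apply: node0; rewrite !inE ?eqxx ?xI ?xJ.
move: (nodal _ _).[_] (nodal _ _).[_] (nodal _ _).[_] N0 P0 Q0 => N P Q N0 P0 Q0 H.
apply: (mulfI (mulf_neq0 (invr_neq0 N0) (mulf_neq0 (invr_neq0 P0) (invr_neq0 Q0)))).
by rewrite mulr0 -[RHS]H; field; rewrite N0 P0 Q0.
Qed.

(** Suppose that the three linear forms satisfy a relation with nonzero
    coefficients. No index lies in exactly one of the sets, since only one term of
    the relation would survive there. Hence U is the union of the common part and
    of the three disjoint sets U \ I, U \ J, U \ K, which have at least two
    elements each. At an index x of U \ K the relation reads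
    al * nodal (U \ I) (a_x) + be * nodal (U \ J) (a_x) = 0, so that the quotient
    of the two polynomials takes the same value at two indices m and c of U \ K.
    If m is the first index outside the common part, this is one of the
    coincidences excluded by [cross_generic]. *)
Lemma weights_dependent_contra I J K U al be ga m :
  al != 0 -> be != 0 -> ga != 0 ->
  #|I| = k.+1 -> #|J| = k.+1 -> #|K| = k.+1 -> (k.+2 < #|U|)%N ->
  (forall x, (x \in U) = [|| x \in I, x \in J | x \in K]) ->
  (forall x, al * weight a I x + be * weight a J x + ga * weight a K x = 0) ->
  m \in U -> m \notin K ->
  (forall x, x \in U -> ~~ [&& x \in I, x \in J & x \in K] -> (m <= x)%N) ->
  False.
Proof.
move=> al0 be0 ga0 cI cJ cK cU eU dep mU mK mmin.
have inj (X : {set _}) : {in X &, injective a} by move=> u v _ _; exact: a_inj.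
have w0 (X : {set _}) x : x \notin X -> weight a X x = 0 by rewrite /weight => /negPf ->.
have onlyI x : x \in I -> ~~ ((x \notin J) && (x \notin K)).
  move=> xI; apply/negP=> /andP[xJ xK]; have /eqP := dep x.
  by rewrite (w0 _ _ xJ) (w0 _ _ xK) !mulr0 !addr0 mulf_eq0 (negPf al0)
    (negPf (weight_neq0 (inj I) xI)).
have onlyJ x : x \in J -> ~~ ((x \notin I) && (x \notin K)).
  move=> xJ; apply/negP=> /andP[xI xK]; have /eqP := dep x.
  by rewrite (w0 _ _ xI) (w0 _ _ xK) !mulr0 addr0 add0r mulf_eq0 (negPf be0)
    (negPf (weight_neq0 (inj J) xJ)).
have onlyK x : x \in K -> ~~ ((x \notin I) && (x \notin J)).
  move=> xK; apply/negP=> /andP[xI xJ]; have /eqP := dep x.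
  by rewrite (w0 _ _ xI) (w0 _ _ xJ) !mulr0 !add0r mulf_eq0 (negPf ga0)
    (negPf (weight_neq0 (inj K) xK)).
have cD (X : {set _}) : #|X| = k.+1 -> {subset X <= U} -> (1 < #|U :\: X|)%N.
  move=> cX sX; rewrite cardsD (finset.setIidPr _) ?cX; last exact/fintype.subsetP.
  by rewrite ltn_subRL addn1.
have [sI sJ sK] : [/\ {subset I <= U}, {subset J <= U} & {subset K <= U}].
  by split=> x xX; rewrite eU xX ?orbT.
have eA : J :\: I = U :\: I.
  apply/finset.setP=> x; rewrite !inE eU; have := onlyK x.
  by case: (x \in I); case: (x \in J); case: (x \in K) => //= /(_ isT).
have eB : I :\: J = U :\: J.
  apply/finset.setP=> x; rewrite !inE eU; have := onlyK x.
  by case: (x \in I); case: (x \in J); case: (x \in K) => //= /(_ isT).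
have inIJ x : x \in U -> x \notin K -> (x \in I) && (x \in J).
  rewrite eU; have := onlyI x; have := onlyJ x.
  by case: (x \in I); case: (x \in J); case: (x \in K) => //= ? ? // /(_ isT).
(* A second index of U \ K, besides m. *)
have [c cC cm] : exists2 c, c \in U :\: K & c != m.
  have /card_gt1P[x [y [xC yC xy]]] := cD K cK sK.
  have [xm|xm] := eqVneq x m; last by exists x.
  by exists y => //; rewrite -xm eq_sym.
move: cC; rewrite !inE => /andP[cK' cU'].
have /andP[mI mJ] := inIJ m mU mK; have /andP[cI' cJ'] := inIJ c cU' cK'.
have pair x : x \in I -> x \in J -> x \notin K ->
    al * (nodal a (J :\: I)).[a x] + be * (nodal a (I :\: J)).[a x] = 0.
  move=> xI xJ xK; apply: weight_pair_eq0 => //.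
  by have := dep x; rewrite (w0 _ _ xK) mulr0 addr0.
have := @a_gen m c (J :\: I) (I :\: J) isT.
have -> : c |: ((J :\: I) :|: (I :\: J)) \subset upper n m.+1.
  apply/fintype.subsetP => x xin; rewrite inE ltn_neqAle.
  have xm : x != m.
    by apply: contraTneq xin => ->; rewrite !inE mI mJ /= orbF eq_sym.
  rewrite eq_sym (inj_eq val_inj) xm /=; apply: mmin.
    by move: xin; rewrite eU !inE => /or3P[/eqP->|/andP[_ ->]|/andP[_ ->]]; rewrite ?cI' ?orbT.
  move: xin; rewrite !inE => /or3P[/eqP->|/andP[/negPf-> _]|/andP[/negPf-> _]] //=.
    by rewrite (negPf cK') !andbF.
  by rewrite andbF.
have -> : J :\: I != finset.set0 by rewrite eA -card_gt0 ltnW // cD.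
have -> : [disjoint J :\: I & I :\: J].
  by apply/pred0P=> x; rewrite /= !inE; case: (x \in I); rewrite ?andbF.
have -> : c \notin (J :\: I) :|: (I :\: J) by rewrite !inE cI' cJ'.
move=> /(_ isT isT isT isT) /eqP; apply.
have := pair m mI mJ mK; have := pair c cI' cJ' cK'.
move: (nodal _ _).[_] (nodal _ _).[_] (nodal _ _).[_] (nodal _ _).[_] => Bm Am Bc Ac Hc Hm.
apply: (mulfI be0); apply/eqP; rewrite -subr_eq0; apply/eqP.
transitivity (Am * (al * Ac + be * Bc) - Ac * (al * Am + be * Bm)); first by ring.
by rewrite Hc Hm !mulr0 subrr.
Qed.

(** The relation is symmetric in the three sets, one of which misses the first index
    outside their common part. *)
Lemma weights_independent I J K al be ga :
  al != 0 -> be != 0 -> ga != 0 ->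
  #|I| = k.+1 -> #|J| = k.+1 -> #|K| = k.+1 -> (k.+2 < #|I :|: J :|: K|)%N ->
  exists x, al * weight a I x + be * weight a J x + ga * weight a K x != 0.
Proof.
move=> al0 be0 ga0 cI cJ cK; set U := I :|: J :|: K => cU.
apply: contrapT => no.
have dep x : al * weight a I x + be * weight a J x + ga * weight a K x = 0.
  by apply/eqP; apply: contra_notT no => wx; exists x.
have eU x : (x \in U) = [|| x \in I, x \in J | x \in K] by rewrite !inE orbA.
have : (0 < #|U :\: K|)%N.
  rewrite cardsD (finset.setIidPr _) ?cK ?subn_gt0 1?ltnW //.
  by apply/fintype.subsetP=> x xK; rewrite eU xK !orbT.
rewrite card_gt0 => /finset.set0Pn[z]; rewrite inE => /andP[zK zU].
pose P x := (x \in U) && ~~ [&& x \in I, x \in J & x \in K].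
have Pz : P z by rewrite /P zU (negPf zK) !andbF.
case: (@arg_minnP _ z P val Pz) => m /andP[mU mIJK] mmin.
have mm x : x \in U -> ~~ [&& x \in I, x \in J & x \in K] -> (m <= x)%N.
  by move=> xU xn; apply: mmin; rewrite /P xU.
(* According to the set missed by m, the three sets are permuted cyclically. *)
have [mK|mK] := boolP (m \in K); last first.
  exact: (weights_dependent_contra al0 be0 ga0 cI cJ cK cU eU dep mU mK mm).
have [mJ|mJ] := boolP (m \in J); last first.
  apply: (weights_dependent_contra ga0 al0 be0 cK cI cJ cU _ _ mU mJ).
  - by move=> x; rewrite eU; case: (x \in I); case: (x \in J); case: (x \in K).
  - by move=> x; rewrite -[RHS](dep x); ring.
  move=> x xU xn; apply: mm xU _; move: xn.
  by case: (x \in I); case: (x \in J); case: (x \in K).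
have mI : m \notin I by move: mIJK; rewrite mJ mK !andbT.
apply: (weights_dependent_contra be0 ga0 al0 cJ cK cI cU _ _ mU mI).
- by move=> x; rewrite eU; case: (x \in I); case: (x \in J); case: (x \in K).
- by move=> x; rewrite -[RHS](dep x); ring.
move=> x xU xn; apply: mm xU _; move: xn.
by case: (x \in I); case: (x \in J); case: (x \in K).
Qed.

End Independence.

(** * Perturbation *)

Section Perturbation.
Variables (R : realType) (n : nat).
Implicit Types (c g : 'I_n -> R).

(** Up to scaling by s^n, this is a small perturbation of g when s is large. The
    exponents are distinct, so that a linear form c gives a polynomial in s with
    coefficients c_i below degree n, and with the value of c at g in degree n. *)
Definition perturbation g (s : R) (i : 'I_n) : R := g i * s ^+ n + s ^+ i.

Let pairing c g : {poly R} := \sum_i c i *: (g i *: 'X^n + 'X^i).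

Let horner_pairing c g s : (pairing c g).[s] = \sum_i c i * perturbation g s i.
Proof. by rewrite horner_sum; apply: eq_bigr => i _; rewrite !hornerE. Qed.

Let coef_pairing_lt c g (j : 'I_n) : (pairing c g)`_j = c j.
Proof.
rewrite coef_sum (bigD1 j) //= big1 ?addr0 => [|i ij]; rewrite coefZ coefD coefZ !coefXn.
  by rewrite eqxx (ltn_eqF (ltn_ord j)) mulr0 add0r mulr1.
by rewrite (ltn_eqF (ltn_ord j)) eq_sym (inj_eq val_inj) (negPf ij) !mulr0 addr0 mulr0.
Qed.

Let coef_pairing_n c g : (pairing c g)`_n = \sum_i c i * g i.
Proof.
rewrite coef_sum; apply: eq_bigr => i _; rewrite coefZ coefD coefZ !coefXn eqxx.
by rewrite gtn_eqF ?ltn_ord // mulr1 addr0.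
Qed.

Lemma near_perturbation_gt0 c g : 0 < \sum_i c i * g i ->
  \forall s \near +oo, 0 < \sum_i c i * perturbation g s i.
Proof.
rewrite -coef_pairing_n => /near_poly_gt0 H.
have {}H : \forall s \near +oo, 0 < (pairing c g).[s].
  apply: H; apply: leq_trans (size_sum _ _ _) _; apply/bigmax_leqP => i _.
  apply: leq_trans (size_scale_leq _ _) _; apply: leq_trans (size_polyD _ _) _.
  rewrite geq_max (leq_trans (size_scale_leq _ _)) ?size_polyXn //.
  by rewrite ltnS ltnW.
by apply: filterS H => s; rewrite horner_pairing.
Qed.

Lemma near_perturbation_neq0 c g j : c j != 0 ->
  \forall s \near +oo, \sum_i c i * perturbation g s i != 0.
Proof.
move=> cj; have p0 : pairing c g != 0.
  by apply: contraNneq cj => p0; rewrite -(coef_pairing_lt c g) p0 coef0.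
by apply: filterS (near_poly_neq0 p0) => s; rewrite horner_pairing.
Qed.

End Perturbation.

Section Realization.
Variables (R : realType) (n k : nat).

Lemma lacunary_injective (a : 'I_n -> R) : lacunary a 0 -> injective a.
Proof.
move=> la x y; apply: (lacunary_inj la (fintype.subxx (upper n 0))); by rewrite inE.
Qed.

(** Perturbing g alone suffices: f stays fixed, the inequalities on the ratios and
    the determinants expressing concurrency are linear forms in g, and the
    coefficients of the latter are combinations of weights with nonzero
    coefficients f[K] - f[J], f[I] - f[K], f[J] - f[I]. *)
Lemma ddiff_realization : (0 < k)%N -> exists a f g : 'I_n -> R,
  [/\ lacunary a 0, lex_increasing k a f 0, lex_decreasing_ratio k a f g 0 &
      forall I J K : {set 'I_n}, #|I| = k.+1 -> #|J| = k.+1 -> #|K| = k.+1 ->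
        I != J -> J != K -> I != K -> (k.+2 < #|I :|: J :|: K|)%N ->
        (ddiff a f J - ddiff a f I) * (ddiff a g K - ddiff a g I) !=
        (ddiff a f K - ddiff a f I) * (ddiff a g J - ddiff a g I)].
Proof.
move=> k0; have [a [f [g [la ga incr ratio]]]] := lex_configuration_exists R n k0.
have up (I : {set 'I_n}) : I \subset upper n 0 by apply/fintype.subsetP=> i _; rewrite inE.
have f_neq (I J : {set _}) : #|I| = k.+1 -> #|J| = k.+1 -> I != J -> ddiff a f J - ddiff a f I != 0.
  move=> cI cJ /precedes_total/orP[IJ|JI].
    by rewrite subr_eq0 gt_eqF // incr.
  by rewrite subr_eq0 lt_eqF // incr.
(* The values of these linear forms at g are the difference of the two sides of
   the inequality on ratios, and the determinant expressing concurrency. *)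
pose c1 (L L' : {set _}) i := ddiff a f L' * weight a L i - ddiff a f L * weight a L' i.
pose c2 (I J K : {set _}) i := (ddiff a f K - ddiff a f J) * weight a I i +
   (ddiff a f I - ddiff a f K) * weight a J i + (ddiff a f J - ddiff a f I) * weight a K i.
have e1 (L L' : {set _}) h : \sum_i c1 L L' i * h i =
    ddiff a h L * ddiff a f L' - ddiff a h L' * ddiff a f L.
  rewrite {1 3}/ddiff !mulr_suml -sumrB; apply: eq_bigr => i _; rewrite /c1; ring.
have e2 (I J K : {set _}) h : \sum_i c2 I J K i * h i =
    (ddiff a f J - ddiff a f I) * (ddiff a h K - ddiff a h I) -
    (ddiff a f K - ddiff a f I) * (ddiff a h J - ddiff a h I).
  transitivity ((ddiff a f K - ddiff a f J) * ddiff a h I +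
     (ddiff a f I - ddiff a f K) * ddiff a h J + (ddiff a f J - ddiff a f I) * ddiff a h K);
    last by ring.
  rewrite [in ddiff a h I]/ddiff [in ddiff a h J]/ddiff [in ddiff a h K]/ddiff.
  rewrite !mulr_sumr -!big_split /=; apply: eq_bigr => i _; rewrite /c2; ring.
pose cond1 (L L' : {set 'I_n}) := [&& #|L| == k.+2, #|L'| == k.+2 & precedes L L'].
pose cond2 (I J K : {set 'I_n}) := [&& [&& #|I| == k.+1, #|J| == k.+1 & #|K| == k.+1],
  [&& I != J, J != K & I != K] & (k.+2 < #|I :|: J :|: K|)%N].
have : \forall s \near +oo,
   (forall L L', cond1 L L' -> 0 < \sum_i c1 L L' i * perturbation g s i) /\
   (forall I J K, cond2 I J K -> \sum_i c2 I J K i * perturbation g s i != 0).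
  near=> s; split; near: s.
    apply: near_all => L; apply: near_all => L'; apply: near_impl.
    move=> /and3P[/eqP cL /eqP cL' LL']; apply: near_perturbation_gt0.
    by rewrite e1 subr_gt0 ratio.
  apply: near_all => I; apply: near_all => J; apply: near_all => K; apply: near_impl.
  move=> /and3P[/and3P[/eqP cI /eqP cJ /eqP cK] /and3P[IJ JK IK] cU].
  have [x cx] := weights_independent (lacunary_injective la) ga (f_neq _ _ cJ cK JK)
    (f_neq _ _ cK cI (contra_neq esym IK)) (f_neq _ _ cI cJ IJ) cI cJ cK cU.
  exact: near_perturbation_neq0 cx.
case/filter_ex => s [s1 s2]; exists a, f, (perturbation g s); split=> //.
  move=> L L' _ _ cL cL' LL'; rewrite -subr_gt0 -e1.
  by apply: s1; rewrite /cond1 cL cL' !eqxx.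
move=> I J K cI cJ cK IJ JK IK cU; rewrite -subr_eq0 -e2.
by apply: s2; rewrite /cond2 cI cJ cK !eqxx IJ JK IK.
Unshelve. all: by end_near.
Qed.

End Realization.

(** * Right ends of lines on a circle *)

Section RightEndpoint.
Local Open Scope classical_set_scope.
Local Open Scope ring_scope.
Variable R : realType.
Implicit Types (c p q : R * R) (r M b u v x phi : R).

(** With h the argument of asin, the derivative is
    1 - (v sin phi + u cos phi) / sqrt (1 - h^2), and it is positive because
    h^2 + (v sin phi + u cos phi)^2 = u^2 + v^2 < 1. *)
Lemma angle_plus_asin_mono u v : u ^+ 2 + v ^+ 2 < 1 ->
  {homo (fun phi => phi + asin (v * cos phi - u * sin phi)) : x y / x < y}.
Proof.
move=> uv1 x y xy; pose h : R -> R := (v \*: cos) - (u \*: sin).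
have hE z : h z = v * cos z - u * sin z by [].
have norm z : h z ^+ 2 + (v * sin z + u * cos z) ^+ 2 = u ^+ 2 + v ^+ 2.
  rewrite hE -[RHS]mulr1 -(cos2Dsin2 z); ring.
have hlt z : h z ^+ 2 < 1.
  by apply: le_lt_trans uv1; rewrite -(norm z) lerDl sqr_ge0.
have hbd z : -1 < h z < 1.
  have := hlt z; rewrite -real_normK ?num_real // expr_lt1 // ltr_norml.
  exact.
pose F : R -> R := id + (asin \o h).
pose df (z : R) : R := 1 + (Num.sqrt (1 - h z ^+ 2))^-1 * (v * - sin z - u * cos z).
have dF (z : R) : is_derive z (1 : R) F (df z).
  apply: is_deriveD; apply: is_derive1_comp; exact: is_derive1_asin.
have cF : {within `[x, y], continuous F}.
  by apply: derivable_within_continuous => z _; apply: ex_derive; exact: dF.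
have [z _ E] := MVT xy (fun z _ => dF z) cF.
rewrite -subr_gt0 [X in 0 < X]E mulr_gt0 ?subr_gt0 //.
have s0 : 0 < Num.sqrt (1 - h z ^+ 2) by rewrite sqrtr_gt0 subr_gt0.
rewrite /df -(pmulr_rgt0 _ s0) mulrDr mulr1 mulVKf ?gt_eqF //.
have lt : `|v * sin z + u * cos z| < Num.sqrt (1 - h z ^+ 2).
  rewrite -sqrtr_sqr ltr_sqrt ?subr_gt0 // ltrBrDl norm; exact: uv1.
have := ler_norm (v * sin z + u * cos z); lra.
Qed.

Definition slanted M b : set (R * R) := [set p | p.2 = b - M * p.1].

Lemma slanted_is_line M b : is_line (slanted M b).
Proof.
exists M, 1, b; split; first by move=> [_ /eqP]; rewrite oner_eq0.
by apply/seteqP; split=> p; rewrite /slanted /= => H; lra.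
Qed.

Lemma slanted_not_vertical M b : ~ vertical (slanted M b).
Proof.
move=> [d E].
have : slanted M b (d + 1, b - M * (d + 1)) by [].
by rewrite E /= => /eqP; rewrite -subr_eq0 addrAC subrr add0r oner_eq0.
Qed.

Lemma slanted_inj M b M' b' : slanted M b = slanted M' b' -> M = M'.
Proof.
move=> E; have : slanted M b (0, b - M * 0) by [].
have : slanted M b (1, b - M * 1) by [].
rewrite E /slanted /=; lra.
Qed.

Lemma slantedI M b M' b' p : M != M' ->
  slanted M b p -> slanted M' b' p -> p.1 = (b - b') / (M - M').
Proof.
rewrite -subr_eq0 /slanted /= => MM' -> H; apply: (mulIf MM'); rewrite divfK //; lra.
Qed.

Definition inclination M := atan (- M).

Lemma cos_inclination_gt0 M : 0 < cos (inclination M).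
Proof. by apply: cos_gt0_pihalf; rewrite atan_gtNpi2 atan_ltpi2. Qed.

Lemma sin_inclination M : sin (inclination M) = - M * cos (inclination M).
Proof.
have := atanK (- M); rewrite /tan -/(inclination M) => <-.
by rewrite divfK // gt_eqF // cos_inclination_gt0.
Qed.

(** The signed distance from c to the line, along its upward normal. *)
Definition offset c M b :=
  cos (inclination M) * (b - c.2) + sin (inclination M) * c.1.

Lemma offsetE c M b p : slanted M b p ->
  offset c M b = (p.2 - c.2) * cos (inclination M) - (p.1 - c.1) * sin (inclination M).
Proof. by rewrite /slanted /offset /= => ->; rewrite sin_inclination; ring. Qed.

(** Seen from c, the direction of the right end differs from that of the line by the
    angle whose sine is the signed distance divided by the radius. *)
Definition end_angle c r M b := inclination M + asin (offset c M b / r).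

(** The distance from c to the line is at most the distance to any point of it. *)
Lemma offset_bound c r M b : 0 < r -> (circle c r `&` slanted M b !=set0) ->
  -1 <= offset c M b / r <= 1.
Proof.
move=> r0 [p [pc pl]]; rewrite -ler_norml normrM normfV (gtr0_norm r0).
rewrite ler_pdivrMr // mul1r -(ler_pXn2r (n := 2)) ?nnegrE ?normr_ge0 ?(ltW r0) //.
rewrite real_normK ?num_real // (offsetE c pl) -pc.
have E : (p.1 - c.1) ^+ 2 + (p.2 - c.2) ^+ 2 =
  ((p.2 - c.2) * cos (inclination M) - (p.1 - c.1) * sin (inclination M)) ^+ 2 +
  ((p.1 - c.1) * cos (inclination M) + (p.2 - c.2) * sin (inclination M)) ^+ 2.
  rewrite -[LHS]mulr1 -(cos2Dsin2 (inclination M)); ring.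
by rewrite E lerDl sqr_ge0.
Qed.

Lemma end_angle_bound c r M b : 0 < r -> (circle c r `&` slanted M b !=set0) ->
  - pi < end_angle c r M b < pi.
Proof.
move=> r0 /(offset_bound r0) bd; rewrite /end_angle.
have := asin_geNpi2 bd; have := asin_lepi2 bd.
have := atan_gtNpi2 (- M); have := atan_ltpi2 (- M); rewrite -/(inclination M).
by move=> *; apply/andP; split; lra.
Qed.

(** In the orthonormal frame at c given by the direction and the normal of the line,
    its points on the circle have coordinates (s, offset) with
    s^2 = (r cos al)^2, where cos al >= 0, and the abscissa increases with s. *)
Lemma right_endpoint_end_angle c r M b : 0 < r ->
  (circle c r `&` slanted M b !=set0) ->
  right_endpoint c r (slanted M b) (circle_point c r (end_angle c r M b)).
Proof.
move=> r0 /(offset_bound r0) bd; rewrite /end_angle.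
set phi := inclination M; set al := asin _.
have sin_al : r * sin al = offset c M b.
  by rewrite asinK ?in_itv //= mulrC divfK // gt_eqF.
have cos_al : 0 <= cos al by apply: cos_ge0_pihalf; rewrite asin_geNpi2 ?asin_lepi2.
have cphi : 0 < cos phi := cos_inclination_gt0 M.
have sphi : sin phi = - M * cos phi := sin_inclination M.
have tphi := cos2Dsin2 phi; have tal := cos2Dsin2 al.
split; [split|].
- rewrite /circle /circle_point /= [c.1 + _]addrC addrK [c.2 + _]addrC addrK.
  by rewrite !exprMn -mulrDr cos2Dsin2 mulr1.
- rewrite /slanted /circle_point /= cosD sinD.
  apply: (mulfI (lt0r_neq0 cphi)).
  rewrite [RHS]mulrBr mulrCA [X in _ = _ - X]mulrA (_ : M * cos phi = - sin phi); last first.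
    by rewrite sphi mulNr opprK.
  apply/eqP; rewrite -subr_eq0; apply/eqP.
  transitivity (r * sin al * (cos phi ^+ 2 + sin phi ^+ 2) -
    (cos phi * (b - c.2) + sin phi * c.1)); first by ring.
  by rewrite sin_al tphi mulr1 subrr.
move=> q [qc ql]; rewrite /circle_point /= -lerBlDl cosD.
have oq := offsetE c ql; rewrite -/phi in oq.
pose s := (q.1 - c.1) * cos phi + (q.2 - c.2) * sin phi.
have s2 : s ^+ 2 = (r * cos al) ^+ 2.
  have -> : (r * cos al) ^+ 2 = r ^+ 2 - (r * sin al) ^+ 2.
    by rewrite -[r ^+ 2]mulr1 -tal; ring.
  rewrite sin_al oq -qc -[_ + (q.2 - c.2) ^+ 2]mulr1 -tphi /s; ring.
have sle : s <= r * cos al.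
  apply: le_trans (ler_norm s) _.
  rewrite -(ler_pXn2r (n := 2)) ?nnegrE ?normr_ge0 ?(mulr_ge0 (ltW r0)) //.
  by rewrite real_normK ?num_real // s2.
have -> : q.1 - c.1 = s * cos phi - offset c M b * sin phi.
  rewrite oq -[LHS]mulr1 -tphi /s; ring.
have -> : r * (cos phi * cos al - sin phi * sin al) =
    r * cos al * cos phi - offset c M b * sin phi by rewrite -sin_al; ring.
by rewrite lerD2r ler_pM2r.
Qed.

(** Among lines turning around a point inside the circle, the right end moves
    counterclockwise as the slope - M increases. *)
Lemma end_angle_lt c r M b M' b' p : 0 < r -> M < M' ->
  circle_interior c r p -> slanted M b p -> slanted M' b' p ->
  end_angle c r M' b' < end_angle c r M b.
Proof.
move=> r0 MM' pin pM pM'; rewrite /end_angle (offsetE c pM) (offsetE c pM').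
have lt : inclination M' < inclination M by apply: lt_atan; rewrite ltrN2.
pose u := (p.1 - c.1) / r; pose v := (p.2 - c.2) / r.
have uv : u ^+ 2 + v ^+ 2 < 1.
  by rewrite !expr_div_n -mulrDl ltr_pdivrMr ?exprn_gt0 // mul1r.
have := angle_plus_asin_mono uv lt.
have E x : ((p.2 - c.2) * cos x - (p.1 - c.1) * sin x) / r = v * cos x - u * sin x.
  by rewrite mulrBl /u /v; congr (_ - _); rewrite mulrAC.
by rewrite !E.
Qed.

End RightEndpoint.

Section CommonPoint.
Variable R : realType.

Lemma slanted_meet (M b M' b' : R) : M != M' ->
  exists p, slanted M b p /\ slanted M' b' p.
Proof.
rewrite -subr_eq0 => MM'; exists ((b - b') / (M - M'), b - M * ((b - b') / (M - M'))).
by split=> //; rewrite /slanted /=; field.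
Qed.

Lemma slanted_meet_unique (M b M' b' : R) p q : M != M' ->
  slanted M b p -> slanted M' b' p -> slanted M b q -> slanted M' b' q -> p = q.
Proof.
move=> MM' p1 p2 q1 q2; have e1 : p.1 = q.1.
  by rewrite (slantedI MM' p1 p2) (slantedI MM' q1 q2).
rewrite [p]surjective_pairing [q]surjective_pairing e1; congr (_, _).
by rewrite p1 q1 e1.
Qed.

End CommonPoint.

(** * The arrangement attached to divided differences *)

Section FromDividedDifferences.
Variables (R : realType) (n k : nat) (a f g : 'I_n -> R).
Hypothesis le_k1_n : (k.+1 <= n)%N.
Hypothesis a_inj : injective a.
Implicit Types (I J K L : {set 'I_n}) (p q : R * R).
Hypothesis f_incr : forall I J, #|I| = k.+1 -> #|J| = k.+1 -> precedes I J ->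
  ddiff a f I < ddiff a f J.
Hypothesis f_lt0 : forall L, #|L| = k.+2 -> ddiff a f L < 0.
Hypothesis ratio_decr : forall L L', #|L| = k.+2 -> #|L'| = k.+2 -> precedes L L' ->
  ddiff a g L' * ddiff a f L < ddiff a g L * ddiff a f L'.
Hypothesis noncollinear : forall I J K, #|I| = k.+1 -> #|J| = k.+1 -> #|K| = k.+1 ->
  I != J -> J != K -> I != K -> (k.+2 < #|I :|: J :|: K|)%N ->
  (ddiff a f J - ddiff a f I) * (ddiff a g K - ddiff a g I) !=
  (ddiff a f K - ddiff a f I) * (ddiff a g J - ddiff a g I).

Definition ddiff_line I := slanted (ddiff a f I) (ddiff a g I).

Lemma slope_neq I J : #|I| = k.+1 -> #|J| = k.+1 -> I != J ->
  ddiff a f I != ddiff a f J.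
Proof.
move=> cI cJ /precedes_total/orP[IJ|JI].
  by rewrite lt_eqF // f_incr.
by rewrite gt_eqF // f_incr.
Qed.

(** Three concurrent lines have collinear coefficient pairs (f[I], g[I]). *)
Lemma concurrent_small I J K p : #|I| = k.+1 -> #|J| = k.+1 -> #|K| = k.+1 ->
  I != J -> J != K -> I != K ->
  ddiff_line I p -> ddiff_line J p -> ddiff_line K p ->
  (#|I :|: J :|: K| <= k.+2)%N.
Proof.
move=> cI cJ cK IJ JK IK; rewrite /ddiff_line /slanted /= => pI pJ pK.
rewrite leqNgt; apply/negP => /(noncollinear cI cJ cK IJ JK IK) /eqP; apply.
have -> : ddiff a g I = p.2 + ddiff a f I * p.1 by rewrite pI subrK.
have -> : ddiff a g J = p.2 + ddiff a f J * p.1 by rewrite {1}pJ subrK.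
have -> : ddiff a g K = p.2 + ddiff a f K * p.1 by rewrite {1}pK subrK.
ring.
Qed.

Lemma subset_setD1P L I : #|L| = k.+2 -> #|I| = k.+1 -> I \subset L ->
  exists2 i, i \in L & I = L :\ i.
Proof.
move=> cL cI IL; have : #|L :\: I| == 1%N.
  by rewrite cardsD (finset.setIidPr IL) cL cI subSnn.
case/cards1P=> i e; exists i.
  by have : i \in L :\: I; [rewrite e inE|case/finset.setDP].
by rewrite -e finset.setDDr finset.setDv finset.set0U (finset.setIidPr IL).
Qed.

Lemma card_setD1 L i : #|L| = k.+2 -> i \in L -> #|L :\ i| = k.+1.
Proof. by move=> cL iL; move: cL; rewrite (cardsD1 i) iL => -[]. Qed.

Lemma setD1_neq L i j : i \in L -> i != j -> L :\ i != L :\ j.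
Proof.
move=> iL ij; apply/eqP=> e; have : i \in L :\ j by rewrite !inE ij.
by rewrite -e !inE eqxx.
Qed.

Lemma two_indices L : #|L| = k.+2 -> exists i j, [/\ i \in L, j \in L & i != j].
Proof. by move=> cL; apply/card_gt1P; rewrite cL. Qed.

Lemma node_diff_neq0 (i j : 'I_n) : i != j -> a j - a i != 0.
Proof. by rewrite subr_eq0 eq_sym (inj_eq a_inj). Qed.

(** By [ddiff_exchange], both differences of coefficients are proportional to the
    divided differences on L, with the same factor a_j - a_i. *)
Lemma ddiff_line_exchange L i j x : #|L| = k.+2 -> i \in L -> j \in L ->
  x = ddiff a g L / ddiff a f L ->
  ddiff a g (L :\ i) - ddiff a f (L :\ i) * x =
  ddiff a g (L :\ j) - ddiff a f (L :\ j) * x.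
Proof.
move=> cL iL jL ->; apply/eqP; rewrite -subr_eq0; apply/eqP.
have inj : {in L &, injective a} by move=> u v _ _; exact: a_inj.
transitivity ((ddiff a g (L :\ i) - ddiff a g (L :\ j)) -
  (ddiff a f (L :\ i) - ddiff a f (L :\ j)) * (ddiff a g L / ddiff a f L)).
  by ring.
rewrite !ddiff_exchange //; field; exact: ltr0_neq0 (f_lt0 cL).
Qed.

(** A further line through this point would be that of a set I not contained in L.
    Together with two of the sets L \ h, whose union is L, it would contradict
    [concurrent_small]. *)
Lemma multiple_point_ex L : #|L| = k.+2 ->
  exists p, multiple_point k ddiff_line L p.
Proof.
move=> cL; have [i [j [iL jL ij]]] := two_indices cL.
set x := ddiff a g L / ddiff a f L.
pose p := (x, ddiff a g (L :\ i) - ddiff a f (L :\ i) * x).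
have on h : h \in L -> ddiff_line (L :\ h) p.
  by move=> hL; rewrite /ddiff_line /slanted /=; exact: ddiff_line_exchange.
have neq := slope_neq (card_setD1 cL iL) (card_setD1 cL jL) (setD1_neq iL ij).
exists p; split.
  apply/seteqP; split=> q /=.
    move=> qon; apply: (slanted_meet_unique neq (qon _ iL) (qon _ jL)); exact: on.
  by move=> -> h; exact: on.
apply/finset.setP=> I; rewrite inE; apply/andP/imsetP; last first.
  by case=> h hL ->; rewrite card_setD1 // eqxx; split=> //; apply/asboolP/on.
case=> /eqP cI /asboolP pI; have [IL|IL] := boolP (I \subset L).
  by have [h hL ->] := subset_setD1P cL cI IL; exists h.
have notin h : h \in L -> L :\ h != I.
  by move=> hL; apply: contraNneq IL => <-; exact: subsetDl.
have := concurrent_small (card_setD1 cL iL) (card_setD1 cL jL) cI (setD1_neq iL ij)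
  (notin _ jL) (notin _ iL) (on _ iL) (on _ jL) pI.
have -> : (L :\ i) :|: (L :\ j) = L.
  apply/finset.setP=> z; rewrite !inE; case: (z \in L); rewrite ?andbF ?andbT //=.
  by case: (eqVneq z i) => // ->; rewrite ij.
have : (#|L| < #|L :|: I|)%N.
  by apply: proper_card; rewrite finset.properUl.
by rewrite cL ltnNge => /negPf ->.
Qed.

(** Here the union of I and J already has more than k+2 elements, which excludes a
    third line by [concurrent_small]. *)
Lemma double_point_ex I J : #|I| = k.+1 -> #|J| = k.+1 -> (#|I :&: J| < k)%N ->
  exists p, double_point k ddiff_line I J p.
Proof.
move=> cI cJ cIJ; have IJ : I != J.
  by apply: contraTneq cIJ => <-; rewrite finset.setIid cI -leqNgt.
have neq := slope_neq cI cJ IJ.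
have [p [pI pJ]] := slanted_meet (ddiff a g I) (ddiff a g J) neq.
exists p; split.
  apply/seteqP; split=> q /=; last by move=> ->.
  by case=> qI qJ; exact: slanted_meet_unique neq qI qJ pI pJ.
apply/finset.setP=> K; rewrite !inE; apply/andP/orP; last first.
  by case=> /eqP ->; rewrite ?cI ?cJ eqxx; split=> //; apply/asboolP.
case=> /eqP cK /asboolP pK.
have [_|IK] := eqVneq I K; first by left.
have [_|JK] := eqVneq J K; first by right.
have := concurrent_small cI cJ cK IJ JK IK pI pJ pK.
have : (#|I :|: J| <= #|I :|: J :|: K|)%N by rewrite fintype.subset_leq_card ?finset.subsetUl.
by rewrite cardsU cI cJ; lia.
Qed.

Lemma ddiff_lexL2 : lexL2 k ddiff_line.
Proof.
split; [exact: double_point_ex|exact: multiple_point_ex|].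
move=> p [I [J [cI cJ /eqP IJ [pI pJ]]]].
have [cIJ|cIJ] := ltnP #|I :&: J| k.
  left; exists I, J; split=> //.
  have [q dq] := double_point_ex cI cJ cIJ.
  by have [E _] := dq; have : (ddiff_line I `&` ddiff_line J)%classic p by []; rewrite E => ->.
right; exists (I :|: J).
have cU : #|I :|: J| = k.+2.
  have : (#|I :&: J| < k.+1)%N.
    rewrite ltnNge; apply: contra IJ => cge.
    have eI : I :&: J = I by apply/eqP; rewrite eqEcard finset.subsetIl cI.
    have eJ : I :&: J = J by apply/eqP; rewrite eqEcard finset.subsetIr cJ.
    by rewrite -eI eJ.
  by rewrite cardsU cI cJ; lia.
split=> //; have [q mq] := multiple_point_ex cU.
have on K : #|K| = k.+1 -> K \subset I :|: J -> ddiff_line K q.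
  move=> cK /(subset_setD1P cU cK)[i iU ->]; have [_ E] := mq.
  have : (I :|: J) :\ i \in lines_through k ddiff_line q by rewrite E; apply/imsetP; exists i.
  by rewrite inE => /andP[_ /asboolP].
suff -> : p = q by [].
apply: (slanted_meet_unique (slope_neq cI cJ IJ) pI pJ); apply: on => //.
  exact: finset.subsetUl.
exact: finset.subsetUr.
Qed.

Lemma multiple_point_abscissa L p : #|L| = k.+2 ->
  multiple_point k ddiff_line L p -> p.1 = ddiff a g L / ddiff a f L.
Proof.
move=> cL [E _]; have [i [j [iL jL ij]]] := two_indices cL.
have on h : h \in L -> ddiff_line (L :\ h) p.
  by move=> hL; have : [set p]%classic p by []; rewrite -E => /(_ h hL).
have neq := slope_neq (card_setD1 cL iL) (card_setD1 cL jL) (setD1_neq iL ij).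
have inj : {in L &, injective a} by move=> u v _ _; exact: a_inj.
rewrite (slantedI neq (on _ iL) (on _ jL)) !ddiff_exchange //.
by field; rewrite ltr0_neq0 ?f_lt0 // node_diff_neq0.
Qed.

Lemma ddiff_lexL3 : lexL3 k ddiff_line.
Proof.
move=> L L' p p' cL cL' /(multiple_point_abscissa cL) -> /(multiple_point_abscissa cL') ->.
move=> /(lexlt_precedes (etrans cL (esym cL'))) /(ratio_decr cL cL') lt.
rewrite ltr_ndivrMr ?f_lt0 // mulrAC ltr_ndivrMr ?f_lt0 //.
Qed.

Lemma card_first_index : #|first_index n k| = k.+1.
Proof.
rewrite -sum1_card (eq_bigl (fun i : 'I_n => i < k.+1)%N) => [|i]; last by rewrite inE.
by rewrite -(big_ord_widen n (fun=> 1%N) le_k1_n) sum_nat_const card_ord muln1.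
Qed.

Lemma first_index_precedes I : #|I| = k.+1 -> I != first_index n k ->
  precedes (first_index n k) I.
Proof.
move=> cI neq; have /orP[/precedesP[i [iI + agree]]|//] := precedes_total neq.
rewrite inE -leqNgt => ki.
have : first_index n k \subset I.
  apply/fintype.subsetP=> x xF; rewrite agree //; apply: leq_trans ki.
  by move: xF; rewrite inE.
move=> sub; move: neq; rewrite eq_sym.
by rewrite eqEcard sub cI card_first_index leqnn.
Qed.

(** All end angles lie between - pi and pi, so that two of them differ by less than a
    full turn and their order is the order in which the ends are met. That order
    is the order of the slopes, because any two of the lines cross inside the
    circle. *)
Lemma ddiff_lexL1 : lexL1 k ddiff_line.
Proof.
move=> c r r0 inside meets.
pose theta (I : {set 'I_n}) := end_angle c r (ddiff a f I) (ddiff a g I).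
have theta_lt (I J : {set 'I_n}) : #|I| = k.+1 -> #|J| = k.+1 -> precedes I J -> theta J < theta I.
  move=> cI cJ IJ; have lt := f_incr cI cJ IJ.
  have neq : ddiff a f I != ddiff a f J by rewrite lt_eqF.
  have [p [pI pJ]] := slanted_meet (ddiff a g I) (ddiff a g J) neq.
  apply: (end_angle_lt r0 lt _ pI pJ); apply: inside; exists I, J; split=> //.
  by move=> e; rewrite e ltxx in lt.
have bound (I : {set 'I_n}) : #|I| = k.+1 -> - pi < theta I < pi.
  by move=> cI; apply: end_angle_bound => //; exact: meets.
exists (fun I => circle_point c r (theta I)); split.
  by move=> I cI; apply: right_endpoint_end_angle => //; exact: meets.
exists (fun I => theta (first_index n k) - theta I); split.
  move=> I cI; split.
    have /andP[l1 u1] := bound _ cI; have /andP[l2 u2] := bound _ card_first_index.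
    apply/andP; split; last by lra.
    rewrite subr_ge0; have [->//|neq] := eqVneq I (first_index n k).
    by rewrite ltW // theta_lt ?card_first_index ?first_index_precedes.
  by exists (theta (first_index n k)); split=> //; rewrite subKr.
move=> I J cI cJ /(lexlt_precedes (etrans cI (esym cJ))) IJ.
by rewrite ltrD2l ltrN2 theta_lt.
Qed.

Lemma ddiff_line_arrangement : line_arrangement k ddiff_line.
Proof.
split=> [I _|I J cI cJ /slanted_inj e].
  by split; [exact: slanted_is_line|exact: slanted_not_vertical].
by apply/eqP; apply: contraTT isT => /(slope_neq cI cJ); rewrite e eqxx.
Qed.

End FromDividedDifferences.

Theorem proposition5p2 (R : realType) (n k : nat)
    (n_gt0 : (0 < n)%N) (k_gt0 : (0 < k)%N) (le_k1_n : (k.+1 <= n)%N) :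
  exists l : {set 'I_n} -> set (R * R),
    @lexicographic_line_arrangement R n k l.
Proof.
have [a [f [g [la incr ratio generic]]]] := ddiff_realization R n k_gt0.
have up (I : {set 'I_n}) : I \subset upper n 0.
  by apply/fintype.subsetP=> i _; rewrite inE.
have a_inj := lacunary_injective la.
have f_incr (I J : {set 'I_n}) : #|I| = k.+1 -> #|J| = k.+1 -> precedes I J ->
    ddiff a f I < ddiff a f J by exact: incr.
have f_lt0 (L : {set 'I_n}) : #|L| = k.+2 -> ddiff a f L < 0.
  exact: lex_increasing_ddiff_lt0 la incr (up L).
exists (ddiff_line a f g); split.
- exact: ddiff_line_arrangement.
- exact: ddiff_lexL1.
- exact: ddiff_lexL2.
- by apply: ddiff_lexL3 => // L L'; exact: ratio.
Qed.
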